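(* Let $(A,\cdot)$ be an antiassociative algebra. Then $(A,\cdot)$ is an $\mathcal{A}\mathrm{BD}$-algebra if and only if $x\cdot(y\cdot z)=(z\cdot y)\cdot x$ for all $x,y,z\in A$.
   Context: All algebras are over $\mathbb{C}$; an algebra $(A,\cdot)$ is a vector space with a bilinear (not necessarily associative) multiplication. Write $x\circ y = x\cdot y+y\cdot x$. An algebra is antiassociative if $(x\cdot y)\cdot z+x\cdot(y\cdot z)=0$ for all $x,y,z$. An algebra $(A,\cdot)$ is called an $\mathcal{A}\mathrm{BD}$-algebra (algebra of anti-biderivation-type) if for all $x,y,z\in A$: $x\cdot(y\circ z) = -\big((x\cdot y)\circ z+y\circ(x\cdot z)\big)$ and $(y\circ z)\cdot x=-\big((y\cdot x)\circ z+y\circ(z\cdot x)\big)$. *)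

(* Defs.v *)
From HB Require Import structures.
From mathcomp Require Import all_boot all_order all_algebra.
From mathcomp Require Import reals complex.
Set Implicit Arguments.
Unset Strict Implicit.
Unset Printing Implicit Defensive.
Import GRing.Theory.
Local Open Scope ring_scope.

(* An algebra over C is a C-vector space A, of arbitrary dimension, with a
   multiplication mul : {bilinear A -> A -> A}. MathComp's algType is not usable
   here, as it is associative and unital. *)

Section AntiBiderivation.
Variables (K : fieldType) (A : lmodType K) (mul : {bilinear A -> A -> A}).

Definition anticomm (x y : A) : A := mul x y + mul y x.

Definition antiassociative : Prop :=
  forall x y z : A, mul (mul x y) z + mul x (mul y z) = 0.

Definition ABD_algebra : Prop :=
  forall x y z : A,
    mul x (anticomm y z) = - (anticomm (mul x y) z + anticomm y (mul x z)) /\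
    mul (anticomm y z) x = - (anticomm (mul y x) z + anticomm y (mul z x)).

End AntiBiderivation.

(* Main.v *)
(* Antiassociativity turns every triple product into some [x (y z)] up to sign.
   After this rewriting and cancellation, each of the two identities defining an
   ABD-algebra, as well as the identity [x (y z) = (z y) x], says that [x (y z)]
   is antisymmetric in its outer variables. *)
Require Import Defs.
From HB Require Import structures.
From mathcomp Require Import all_boot all_order all_algebra.
From mathcomp Require Import reals complex.
Set Implicit Arguments.
Unset Strict Implicit.
Unset Printing Implicit Defensive.
Import GRing.Theory.
Local Open Scope ring_scope.

Section Antiassociative.
Variables (K : fieldType) (A : lmodType K) (mul : {bilinear A -> A -> A}).
Hypothesis mulNA : antiassociative mul.

Lemma antiassociativeE x y z : mul (mul x y) z = - mul x (mul y z).
Proof. by apply/eqP; rewrite -addr_eq0 mulNA. Qed.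

(** The difference of the two sides of the first ABD identity: [(x y) z] and [(x z) y] turn into
    [- x (y z)] and [- x (z y)], which cancel the expansion of the left side. *)
Lemma antiassociative_anticommr x y z :
  mul x (anticomm mul y z) +
    (anticomm mul (mul x y) z + anticomm mul y (mul x z)) =
  mul y (mul x z) + mul z (mul x y).
Proof.
rewrite /anticomm linearD /= !antiassociativeE.
rewrite [mul y _ - _]addrC (addrACA (- _)) -opprD.
by rewrite addNKr addrC.
Qed.

(** Here [(y z) x] and [(z y) x] turn into [- y (z x)] and [- z (y x)] and cancel, so the second
    identity has the same defect as the first, up to sign. *)
Lemma antiassociative_anticomml x y z :
  mul (anticomm mul y z) x +
    (anticomm mul (mul y x) z + anticomm mul y (mul z x)) =
  - (mul y (mul x z) + mul z (mul x y)).
Proof.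
rewrite /anticomm linearDl /= !antiassociativeE.
rewrite [mul y _ - _]addrC (addrACA (- mul y (mul x z))) -!opprD.
rewrite [mul z (mul y x) + _]addrC.
by rewrite addrC addKr.
Qed.

Lemma antiassociative_ABD :
  ABD_algebra mul <-> forall x y z, mul x (mul y z) = mul (mul z y) x.
Proof.
split=> [abd x y z | rev x y z].
  (* Swapping [x] and [y] puts [y] in the middle: the defect is [x (y z) + z (y x)]. *)
  have [/eqP + _] := abd y x z.
  rewrite -addr_eq0 antiassociative_anticommr addr_eq0 => /eqP ->.
  by rewrite antiassociativeE.
have outer0 : mul y (mul x z) + mul z (mul x y) = 0.
  by rewrite rev antiassociativeE addNr.
split; apply/eqP; rewrite -addr_eq0.
  by rewrite antiassociative_anticommr outer0.
by rewrite antiassociative_anticomml outer0 oppr0.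
Qed.

End Antiassociative.

(* R[i], for R : realType, is the field of complex numbers. *)
Theorem corollary57 (R : realType) (A : lmodType R[i])
    (mul : {bilinear A -> A -> A}) (hA : antiassociative mul) :
  ABD_algebra mul <->
  (forall x y z : A, mul x (mul y z) = mul (mul z y) x).
Proof. exact: antiassociative_ABD. Qed.
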